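(* Let $X,Y$ be normed spaces, $q>0$, $F:X\rightrightarrows Y$ a set-valued mapping and $(\bar x,\bar y)\in\mathrm{gph}\,F$. Consider the following conditions: (i) $F$ is $q$-order strongly subregular at $(\bar x,\bar y)$; (ii) $\|D_qF(\bar x,\bar y)\|^{\circleddash}_q>0$; (iii) $D_qF(\bar x,\bar y)^{-1}(0)=\{0\}$. Then (i) $\Rightarrow$ (ii) $\Rightarrow$ (iii). If $\dim X<+\infty$ and $\dim Y<+\infty$, then (i) $\Leftrightarrow$ (ii) $\Leftrightarrow$ (iii).
   Context: A set-valued mapping $F:X\rightrightarrows Y$ assigns to each $x\in X$ a (possibly empty) subset $F(x)\subset Y$; $\mathrm{gph}\,F=\{(x,y): y\in F(x)\}$ and $F^{-1}(y)=\{x: y\in F(x)\}$. $F$ is $q$-order strongly subregular at $(\bar x,\bar y)\in\mathrm{gph}\,F$ if there exist $\tau>0$ and neighbourhoods $U$ of $\bar x$ and $V$ of $\bar y$ such that $\tau\|x-\bar x\|^q\le d(\bar y,F(x)\cap V)$ for all $x\in U$ (with $d(\bar y,\emptyset)=+\infty$). The $q$-order graphical derivative $D_qF(\bar x,\bar y):X\rightrightarrows Y$ is defined by: $y\in D_qF(\bar x,\bar y)(x)$ iff there exist $(x_k,y_k)\to(x,y)$ and $t_k\downarrow0$ with $(\bar x+t_kx_k,\bar y+t_k^qy_k)\in\mathrm{gph}\,F$ for all $k\in\mathbb N$. A mapping $H:X\rightrightarrows Y$ is $q$-order positively homogeneous if $0\in H(0)$ and $H(\lambda x)=\lambda^qH(x)$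 for all $x\in X$, $\lambda>0$ ($D_qF(\bar x,\bar y)$ is such a mapping). For such $H$, $\|H\|^{\circleddash}_q:=\inf_{(x,y)\in\mathrm{gph}\,H\setminus\{(0,0)\}}\|y\|/\|x\|^q\in[0,+\infty]$, with $a/0=+\infty$ for $a>0$ and $\inf\emptyset=+\infty$. *)

(* Defs.v *)
From HB Require Import structures.
From mathcomp Require Import all_boot all_order all_algebra.
From mathcomp Require Import all_classical all_reals all_analysis.

Set Implicit Arguments.
Unset Strict Implicit.
Unset Printing Implicit Defensive.

Import Order.TTheory GRing.Theory Num.Theory.
Import numFieldNormedType.Exports.

Local Open Scope classical_set_scope.
Local Open Scope ring_scope.

(* A set-valued mapping from X to Y is a function F : X -> set Y. *)
Section SetValued.
Context {X Y : Type}.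
Implicit Type F : X -> set Y.

Definition gph F : set (X * Y) := [set p | F p.1 p.2].

Definition inv_mapping F : Y -> set X := fun y => [set x | F x y].

End SetValued.

(* The library states edist through balls; on a normed space it is the
   distance induced by the norm. Hence edist_inf A y is the usual d(y, A),
   with value +oo when A is empty. *)
Lemma edist_norm {R : realType} {Y : normedModType R} (y z : Y) :
  edist (y, z) = `|y - z|%:E.
Proof.
apply/eqP; rewrite eq_le; apply/andP; split.
- apply/lee_addgt0Pr => e e0; rewrite -EFinD.
  apply: edist_fin; first by rewrite ltr_wpDl.
  by rewrite -ball_normE /= ltrDl.
- apply: le_ereal_inf_tmp => _ [r [r0 +] <-].
  by rewrite -ball_normE /= lee_fin => /ltW.
Qed.

Section OrderQ.
Context {R : realType} {X Y : normedModType R}.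

Definition strongly_subregular (q : R) (F : X -> set Y) (xbar : X) (ybar : Y) :=
  exists tau : R, 0 < tau /\
  exists U : set X, nbhs xbar U /\
  exists V : set Y, nbhs ybar V /\
  forall x : X, U x ->
    ((tau * `|x - xbar| `^ q)%:E <= edist_inf (F x `&` V) ybar)%E.

(* t_k "decreases to 0" is read, as usual in variational analysis, as
   t_k > 0 and t_k --> 0; the sequence need not be monotone. *)
Definition graphical_derivative (q : R) (F : X -> set Y) (xbar : X) (ybar : Y)
    : X -> set Y :=
  fun x => [set y | exists (u : nat -> X) (v : nat -> Y) (t : nat -> R),
    [/\ (u k, v k) @[k --> \oo] --> (x, y),
        forall k, 0 < t k,
        t k @[k --> \oo] --> 0 &
        forall k, gph F (xbar + t k *: u k, ybar + (t k `^ q) *: v k)]].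

(* The quotient is the one of \bar R, for which a%:E / 0 = +oo when 0 < a;
   the pair (0, 0) is excluded, and ereal_inf set0 = +oo. Intended for H
   q-order positively homogeneous. *)
Definition inner_modulus (q : R) (H : X -> set Y) : \bar R :=
  ereal_inf [set (`|p.2|%:E / (`|p.1| `^ q)%:E)%E
            | p in gph H `\ ((0, 0) : X * Y)].

End OrderQ.

(* Vector.axiom n X is the type of linear isomorphisms from X to 'rV_n. *)
Definition finite_dimensional (R : realType) (X : normedModType R) : Prop :=
  exists n : nat, inhabited (Vector.axiom n X).

(* Main.v *)
(* If [F] is subregular with constant [tau], the estimate along the sequences
   defining [y \in D_q F (x)] reads [tau |u_k|^q <= |v_k|] after division by
   [t_k^q], hence passes to the limit.  Conversely, if subregularity fails for
   every [tau = 1 / (k + 1)], there are [x_k] and [y_k \in F x_k] with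
   [|y_k - ybar| < |x_k - xbar|^q / (k + 1)]; for [t_k = |x_k - xbar|] the
   directions [(x_k - xbar) / t_k] accumulate at a unit vector, which lies in
   [D_q F^-1 (0)].  Only the unit sphere of [X] needs to be compact. *)
Require Import Defs.
From HB Require Import structures.
From mathcomp Require Import all_boot all_order all_algebra.
From mathcomp Require Import all_classical all_reals all_analysis.

Set Implicit Arguments.
Unset Strict Implicit.
Unset Printing Implicit Defensive.

Import Order.TTheory GRing.Theory Num.Theory.
Import numFieldNormedType.Exports.

Local Open Scope classical_set_scope.
Local Open Scope ring_scope.

Lemma le_edist_infP (R : realType) (Y : normedModType R) (A : set Y) (y : Y)
    (r : R) :
  (r%:E <= edist_inf A y)%E <-> forall z, A z -> r <= `|y - z|.
Proof.
split=> [rA z Az|rA].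
  rewrite -lee_fin -edist_norm; apply: (le_trans rA).
  by apply: ereal_inf_lbound; exists z.
by apply: le_ereal_inf_tmp => _ [z /rA + <-]; rewrite edist_norm lee_fin.
Qed.

Lemma linear_rV_continuous (R : realType) (X : normedModType R) (n : nat)
    (f : {linear 'rV[R]_n -> X}) : continuous f.
Proof.
have -> : (f : 'rV[R]_n -> X) =
    (fun v => \sum_(i < n) v ord0 i *: f (delta_mx ord0 i)).
  apply/funext => v; rewrite {1}(row_sum_delta v) linear_sum.
  by apply: eq_bigr => i _; rewrite linearZ.
apply: continuous_big => [|i _ v]; first exact: add_continuous.
by apply: (cvgZr_tmp (F := nbhs v)); exact: coord_continuous.
Qed.

(** The coordinate isomorphism turns the norm of [X] into a continuous function on row vectors. Its
    minimum on their unit sphere is positive, so by homogeneity its level set [K] is bounded. Being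
    closed as well, [K] is compact, and its continuous image is the sphere of [X]. *)
Lemma compact_unit_sphere (R : realType) (X : normedModType R) :
  finite_dimensional X -> compact [set x : X | `|x| = 1].
Proof.
move=> [n [[g glin [f fK gK]]]].
pose gL : {linear X -> 'rV[R]_n} :=
  HB.pack g (GRing.isLinear.Build _ _ _ _ g glin).
have flin : linear f by exact: (can2_linear (fK : cancel gL f)).
pose fL : {linear 'rV[R]_n -> X} :=
  HB.pack f (GRing.isLinear.Build _ _ _ _ f flin).
have fcont : continuous f by exact: (linear_rV_continuous (f := fL)).
have nfcont : continuous (fun v => `|f v|).
  by move=> v; apply: (cvg_norm (F := nbhs v)); exact: fcont.
pose K := [set v | `|f v| = 1].
have -> : [set x : X | `|x| = 1] = f @` K.
  apply/seteqP; split=> [x x1|_ [v v1 <-]//].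
  by exists (g x); rewrite /K /= fK.
apply: continuous_compact; first exact: continuous_subspaceT.
apply: bounded_closed_compact; last first.
  rewrite (_ : K = (fun v => `|f v|) @^-1` [set 1])//.
  by apply: preimage_closed => //; exact: closed_eq.
(* A minimum is attained only on a nonempty sphere. When the sphere is empty, every row vector is
   zero and boundedness is trivial. *)
have [S0|/set0P S0] := eqVneq [set v : 'rV[R]_n | `|v| = 1] set0.
  have v0 (v : 'rV[R]_n) : v = 0.
    apply/eqP; apply: contrapT => /negP vN0.
    have : [set v : 'rV[R]_n | `|v| = 1] (`|v|^-1 *: v).
      by rewrite /= normrZ normfV normr_id mulVf ?normr_eq0.
    by rewrite S0.
  by exists 0; split=> // M M0 v _ /=; rewrite (v0 v) normr0 ltW.
have Sc : compact [set v : 'rV[R]_n | `|v| = 1].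
  apply: bounded_closed_compact.
    by exists 1; split=> // M M1 v /= ->; exact: ltW.
  rewrite (_ : [set _ | _] = (fun v : 'rV[R]_n => `|v|) @^-1` [set 1])//.
  by apply: preimage_closed => [v _|]; [exact: norm_continuous|exact: closed_eq].
have [c] := compact_EVT_min S0 Sc (continuous_subspaceT nfcont).
rewrite inE /= => c1 cmin.
have fc0 : 0 < `|f c|.
  rewrite normr_gt0; apply/eqP => fc.
  have c0 : c = 0 by rewrite -(gK c) fc; exact: (linear0 gL).
  by move: c1; rewrite c0 normr0 => /esym/eqP; rewrite oner_eq0.
(* For nonzero [v] in [K], minimality at the normalised vector gives
   [|f c| <= |f v| / |v| = 1 / |v|]. *)
exists `|f c|^-1; split; first by rewrite num_real.
move=> M cM v v1; apply: le_trans (ltW cM).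
have [->|vN0] := eqVneq v 0; first by rewrite normr0 invr_ge0.
have nv0 : 0 < `|v| by rewrite normr_gt0.
rewrite -[leLHS]invrK lef_pV2 ?posrE ?invr_gt0//.
have := cmin (`|v|^-1 *: v).
rewrite inE /= normrZ normfV normr_id mulVf ?gt_eqF// => /(_ erefl).
rewrite (_ : f (`|v|^-1 *: v) = `|v|^-1 *: f v); last exact: (linearZ_LR fL).
by rewrite normrZ normfV normr_id v1 mulr1.
Qed.

Section SubregularityCriteria.
Context (R : realType) (X Y : normedModType R) (q : R) (q_gt0 : 0 < q).
Context (F : X -> set Y) (xbar : X) (ybar : Y).

Lemma inner_modulus_gt0 : strongly_subregular q F xbar ybar ->
  (0 < inner_modulus q (graphical_derivative q F xbar ybar))%E.
Proof.
move=> [tau [tau0 [U [nU [V [nV sub]]]]]].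
(* Comparing [x] with [x / 2] rather than with itself spares the continuity of
   the power function. *)
pose m := tau * 2^-1 `^ q.
have m0 : 0 < m by rewrite mulr_gt0// powR_gt0// invr_gt0.
apply: (@lt_le_trans _ _ m%:E); first by rewrite lte_fin.
apply: le_ereal_inf_tmp => _ [[x y] [/= [u [v [t [uv t0 t_0 gF]]]] xy0] <-].
have uC : u k @[k --> \oo] --> x.
  exact: (cvg_comp (H := nbhs x) _ fst uv cvg_fst).
have vC : v k @[k --> \oo] --> y.
  exact: (cvg_comp (H := nbhs y) _ snd uv cvg_snd).
(* If [x = 0] then [y] is nonzero, and [0 ^ q = 0] since [q > 0], so the quotient is [+oo]. *)
have [x0|xN0] := eqVneq x 0.
  rewrite x0 normr0 powR0 ?gt_eqF// inve0 gt0_muley ?leey// lte_fin normr_gt0.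
  by apply/eqP => y0; apply: xy0; rewrite x0 y0.
have nx0 : 0 < `|x| by rewrite normr_gt0.
rewrite inver gt_eqF ?powR_gt0// -EFinM lee_fin ler_pdivlMr ?powR_gt0//.
rewrite /m -mulrA -powRM ?invr_ge0//.
have tq_0 : t k `^ q @[k --> \oo] --> 0.
  by move/cvg_at_rightP: (powR_cvg0 q_gt0); apply.
have xC : xbar + t k *: u k @[k --> \oo] --> xbar.
  rewrite -[X in _ --> X]addr0 -[X in _ + X](scale0r x).
  by apply: cvgD; [exact: cvg_cst|exact: cvgZ].
have yC : ybar + t k `^ q *: v k @[k --> \oo] --> ybar.
  rewrite -[X in _ --> X]addr0 -[X in _ + X](scale0r y).
  by apply: cvgD; [exact: cvg_cst|exact: cvgZ].
have nvC : `|v k| @[k --> \oo] --> `|y| by exact: cvg_norm.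
have nuC : `|u k| @[k --> \oo] --> `|x| by exact: cvg_norm.
(* Only [|v k|] passes to the limit: for large [k] the perturbed points lie in [U] and [V], so
   [tau |u k|^q <= |v k|], while [|u k|] exceeds [|x| / 2]. *)
apply: (cvgr_to_ge nvC); near=> k.
have Uk : U (xbar + t k *: u k) by near: k; exact: xC.
have Vk : V (ybar + t k `^ q *: v k) by near: k; exact: yC.
have := sub _ Uk => /le_edist_infP/(_ _ (conj (gF k) Vk)).
rewrite [xbar + _ - _]addrC addKr opprD addNKr normrN !normrZ.
rewrite (gtr0_norm (t0 k)) (ger0_norm (powR_ge0 _ _)).
rewrite (powRM _ (ltW (t0 k)) (normr_ge0 _)).
rewrite mulrCA ler_pM2l ?powR_gt0//; apply: le_trans.
rewrite ler_pM2l//.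
apply: ge0_ler_powR; rewrite ?nnegrE ?mulr_ge0 ?invr_ge0//; first exact: ltW.
apply: ltW; near: k; apply: (cvgr_gt _ nuC).
by rewrite gtr_pMl// invf_lt1// ltr1n.
Unshelve. all: by end_near. Qed.

(** A nonzero [x] in the kernel would put the quotient [0] among those whose infimum is taken. *)
Lemma graphical_derivative_inv0 : gph F (xbar, ybar) ->
  (0 < inner_modulus q (graphical_derivative q F xbar ybar))%E ->
  inv_mapping (graphical_derivative q F xbar ybar) 0 = [set 0].
Proof.
move=> gF m0; apply/seteqP; split=> [x /= Dx|_ ->].
  apply: contrapT => x0; move: m0; apply/negP; rewrite -leNgt.
  apply: ereal_inf_lbound; exists (x, 0) => /=; last by rewrite normr0 mul0e.
  by split => // -[].
(* Zero directions never leave [(xbar, ybar)], so any positive null sequence of steps shows that [0]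
   is in the kernel. *)
exists (cst 0), (cst 0), harmonic; split => [|k||k].
- by apply: cvg_pair; exact: cvg_cst.
- exact: harmonic_gt0.
- exact: cvg_harmonic.
- by rewrite !scaler0 !addr0.
Qed.

Lemma strongly_subregular_inv0 : compact [set x : X | `|x| = 1] ->
  inv_mapping (graphical_derivative q F xbar ybar) 0 = [set 0] ->
  strongly_subregular q F xbar ybar.
Proof.
move=> cS D0; apply: contrapT => Nsub.
(* Failure of subregularity is tested with [tau = 1 / (k + 1)], the ball of that radius as [U], and
   the whole space as [V]. *)
have /choice[p pP] (k : nat) : exists p : X * Y, [/\ F p.1 p.2,
    `|p.1 - xbar| < harmonic k &
    `|ybar - p.2| < harmonic k * `|p.1 - xbar| `^ q].
  apply: contrapT => Np; apply: Nsub; exists (harmonic k).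
  split; first exact: harmonic_gt0.
  exists (ball xbar (harmonic k)).
  split; first exact: (nbhsx_ballx _ _ (harmonic_gt0 _)).
  exists setT; split; first exact: filterT.
  move=> x; rewrite -ball_normE /= distrC => xk.
  apply/le_edist_infP => z [Fz _]; rewrite leNgt.
  by apply/negP => zk; apply: Np; exists (x, z).
pose t k := `|(p k).1 - xbar|.
(* At [t k = 0] the strict bound on [|ybar - p.2|] would read [< 0], again because [0 ^ q = 0]. *)
have t0 k : 0 < t k.
  rewrite lt_neqAle normr_ge0 andbT eq_sym; apply/eqP => tk0.
  have [_ _] := pP k; rewrite -/(t k) tk0 powR0 ?gt_eqF// mulr0.
  by rewrite ltNge normr_ge0.
pose u k := (t k)^-1 *: ((p k).1 - xbar).
pose v k := (t k `^ q)^-1 *: ((p k).2 - ybar).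
have u1 k : `|u k| = 1.
  by rewrite normrZ normfV (gtr0_norm (t0 k)) mulVf// gt_eqF.
have v_lt k : `|v k| < harmonic k.
  rewrite normrZ normfV ger0_norm ?powR_ge0// mulrC ltr_pdivrMr ?powR_gt0//.
  by rewrite distrC; have [] := pP k.
have uS : (u k @[k --> \oo]) [set x : X | `|x| = 1].
  by exists 0%N => // k _; exact: u1.
have [x [x1 clx]] := cS _ _ uS.
(* Compactness yields a cluster point [x], so [u] returns near [x] beyond every index. The condition
   [j <= s j] carries the harmonic bounds on [t] and [v] over to the selected terms. *)
have /choice[s sP] (j : nat) : exists k, (j <= k)%N /\ `|x - u k| < harmonic j.
  have [||_ [[k jk <-]]] :=
    clx (u @` [set k | (j <= k)%N]) (ball x (harmonic j)).
  - by exists j => // k /= jk; exists k.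
  - exact: (nbhsx_ballx _ _ (harmonic_gt0 _)).
  by rewrite -ball_normE => xk; exists k.
have harmonic_s j : harmonic (s j) <= harmonic j :> R.
  by rewrite lef_pV2 ?posrE// ler_nat ltnS; have [] := sP j.
have cvg_le_harmonic (V : normedModType R) (w : nat -> V) (l : V) :
    (forall j, `|l - w j| <= harmonic j) -> w k @[k --> \oo] --> l.
  move=> wl; apply/cvgrPdist_lt => e e0; near=> j.
  apply: (le_lt_trans (wl j)); near: j.
  exact: (cvgr_lt _ cvg_harmonic).
have : inv_mapping (graphical_derivative q F xbar ybar) 0 x.
  exists (u \o s), (v \o s), (t \o s); split=> [|k //=||k].
  - apply: cvg_pair; apply: cvg_le_harmonic => j /=.
      by apply: ltW; have [] := sP j.
    by rewrite sub0r normrN (le_trans (ltW (v_lt _))).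
  - apply: cvg_le_harmonic => j /=; rewrite sub0r normrN gtr0_norm//.
    by apply: le_trans (harmonic_s j); have [_ /ltW] := pP (s j).
  (* The scalings by [t] and [t ^ q] cancel, giving back the graph point [p (s k)]. *)
  - rewrite /gph /= /u /v !scalerA !divff ?gt_eqF ?powR_gt0// !scale1r.
    by rewrite addrC subrK addrC subrK; have [] := pP (s k).
rewrite D0 => x0; move: x1; rewrite /= x0 normr0 => /esym/eqP.
by rewrite oner_eq0.
Unshelve. all: by end_near. Qed.

End SubregularityCriteria.

Theorem corollary3p5 (R : realType) (X Y : normedModType R) (q : R)
    (q_gt0 : 0 < q) (F : X -> set Y) (xbar : X) (ybar : Y)
    (gphF : gph F (xbar, ybar)) :
  let i := strongly_subregular q F xbar ybar in
  let ii := (0 < inner_modulus q (graphical_derivative q F xbar ybar))%E in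
  let iii := inv_mapping (graphical_derivative q F xbar ybar) 0 = [set 0] in
  [/\ i -> ii,
      ii -> iii &
      finite_dimensional X -> finite_dimensional Y ->
        (i <-> ii) /\ (ii <-> iii)].
Proof.
move=> i ii iii.
have i_ii : i -> ii by exact: inner_modulus_gt0.
have ii_iii : ii -> iii by exact: graphical_derivative_inv0.
split=> // /compact_unit_sphere cS _.
have iii_i : iii -> i by exact: strongly_subregular_inv0.
split; split=> //; first by move=> /ii_iii/iii_i.
by move=> /iii_i/i_ii.
Qed.
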